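(* If $G$ is a finite group, then $\mathrm{Pol}_2(G)$ is finite.
   Context: For groups $G,H$ and $\varphi\colon G\to H$, put $(\Delta_k\varphi)(g):=\varphi(kg)\varphi(g)^{-1}$. A map is polynomial of degree $-1$ if it is constantly $1$, and polynomial of degree $d+1$ ($d\ge-1$) if $\Delta_k\varphi$ is polynomial of degree $d$ for all $k\in G$; quadratic means polynomial of degree $2$; unital means $\varphi(1)=1$. $\mathrm{Pol}_2(G)$ is the group with a universal unital quadratic map $\varphi\colon G\to\mathrm{Pol}_2(G)$: every unital quadratic map $G\to H$ to a group $H$ factors through $\varphi$ via a unique homomorphism $\mathrm{Pol}_2(G)\to H$. Concretely, $\mathrm{Pol}_2(G)$ has generators $\varphi(g)$, $g\in G$, and relations $\varphi(g_1g_2g_3)=\varphi(g_1g_2)\varphi(g_2)^{-1}\varphi(g_1)^{-1}\varphi(g_1g_3)\varphi(g_3)^{-1}\varphi(g_2g_3)$ for all $g_1,g_2,g_3\in G$. *)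

(* Defs.v *)
From HB Require Import structures.
From mathcomp Require Import fingroup.
From mathcomp Require Import all_boot.
From mathcomp Require Import boolp classical_sets functions cardinality.

Set Implicit Arguments.
Unset Strict Implicit.
Unset Printing Implicit Defensive.

Local Open Scope group_scope.
Local Open Scope quotient_scope.

(** * Polynomial maps *)

Definition Delta (G H : groupType) (k : G) (phi : G -> H) (g : G) : H :=
  phi (k * g) * (phi g)^-1.

(* Degrees start at -1, hence the shift: [polynomial_lt n] is
   "polynomial of degree n - 1". *)
Fixpoint polynomial_lt (n : nat) (G H : groupType) (phi : G -> H) : Prop :=
  if n is m.+1 then forall k, polynomial_lt m (Delta k phi)
  else forall g, phi g = 1.

Definition quadratic (G H : groupType) (phi : G -> H) : Prop :=
  polynomial_lt 3 phi.

Definition unital (G H : groupType) (phi : G -> H) : Prop := phi 1 = 1.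

(** * The group Pol_2(G), by generators and relations *)

(* The letter [(g, false)] stands for the generator phi(g), and [(g, true)] for
   its inverse. *)
Notation pol2_word G := (seq (G * bool)).

Definition pol2_inv_letter (G : groupType) (l : G * bool) : G * bool :=
  (l.1, ~~ l.2).

Inductive pol2_eqv (G : groupType) : pol2_word G -> pol2_word G -> Prop :=
| Pol2Refl u : pol2_eqv u u
| Pol2Sym u v : pol2_eqv u v -> pol2_eqv v u
| Pol2Trans u v w : pol2_eqv u v -> pol2_eqv v w -> pol2_eqv u w
| Pol2Cat u u' v v' : pol2_eqv u u' -> pol2_eqv v v' ->
    pol2_eqv (u ++ v) (u' ++ v')
| Pol2Cancel l : pol2_eqv [:: l; pol2_inv_letter l] [::]
| Pol2Rel g1 g2 g3 :
    pol2_eqv [:: (g1 * g2 * g3, false)]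
      [:: (g1 * g2, false); (g2, true); (g1, true);
          (g1 * g3, false); (g3, true); (g2 * g3, false)].

Definition pol2_eqvb (G : groupType) (u v : pol2_word G) : bool :=
  `[< pol2_eqv u v >].

Lemma pol2_eqvbP (G : groupType) (u v : pol2_word G) :
  reflect (pol2_eqv u v) (pol2_eqvb u v).
Proof. exact: asboolP. Qed.

Fact pol2_eqvb_refl (G : groupType) : reflexive (@pol2_eqvb G).
Proof. by move=> u; apply/pol2_eqvbP; apply: Pol2Refl. Qed.

Fact pol2_eqvb_sym (G : groupType) : symmetric (@pol2_eqvb G).
Proof.
by move=> u v; apply/pol2_eqvbP/pol2_eqvbP; apply: Pol2Sym.
Qed.

Fact pol2_eqvb_trans (G : groupType) : transitive (@pol2_eqvb G).
Proof.
move=> v u w /pol2_eqvbP uv /pol2_eqvbP vw.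
by apply/pol2_eqvbP; apply: Pol2Trans uv vw.
Qed.

Canonical pol2_equiv (G : groupType) :=
  EquivRel (@pol2_eqvb G) (@pol2_eqvb_refl G) (@pol2_eqvb_sym G)
    (@pol2_eqvb_trans G).

Definition Pol2 (G : groupType) : Type := {eq_quot (@pol2_eqvb G)}.

HB.instance Definition _ (G : groupType) := 
  Choice.copy (Pol2 G) {eq_quot (@pol2_eqvb G)}.

Section Pol2Group.
Variable G : groupType.
Implicit Types (u v : pol2_word G) (x y z : Pol2 G).

Definition pol2_pi u : Pol2 G := \pi_({eq_quot (@pol2_eqvb G)}) u.

Lemma pol2_piP u v : pol2_pi u = pol2_pi v <-> pol2_eqv u v.
Proof.
split=> [/eqmodP/pol2_eqvbP // | uv].
by apply/eqmodP/pol2_eqvbP.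
Qed.

Lemma pol2_piK x : pol2_pi (repr x) = x.
Proof. exact: reprK. Qed.

Lemma pol2_repr_pi u : pol2_eqv (repr (pol2_pi u)) u.
Proof. by apply/pol2_piP; rewrite pol2_piK. Qed.

Definition pol2_word_inv u : pol2_word G := rev (map (@pol2_inv_letter G) u).

Lemma pol2_inv_letterK : involutive (@pol2_inv_letter G).
Proof. by case=> g b; rewrite /pol2_inv_letter negbK. Qed.

Lemma pol2_word_invK : involutive pol2_word_inv.
Proof.
move=> u; rewrite /pol2_word_inv map_rev revK -map_comp -[RHS]map_id.
by apply: eq_map => l /=; apply: pol2_inv_letterK.
Qed.

Lemma pol2_mulwV u : pol2_eqv (u ++ pol2_word_inv u) [::].
Proof.
elim: u => [|l u IHu]; first exact: Pol2Refl.
rewrite /pol2_word_inv /= rev_cons -/(pol2_word_inv u) -cats1 catA.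
apply: Pol2Trans (Pol2Cancel l).
rewrite -[l :: _ ++ _]/([:: l] ++ _ ++ _) -[[:: l; _]]/([:: l] ++ [:: _]).
apply: Pol2Cat; first exact: Pol2Refl.
rewrite -[X in pol2_eqv _ X]cat0s.
by apply: Pol2Cat => //; apply: Pol2Refl.
Qed.

Lemma pol2_mulVw u : pol2_eqv (pol2_word_inv u ++ u) [::].
Proof. by rewrite -{2}[u]pol2_word_invK; apply: pol2_mulwV. Qed.

Lemma pol2_word_inv_eqv u v :
  pol2_eqv u v -> pol2_eqv (pol2_word_inv u) (pol2_word_inv v).
Proof.
move=> uv; apply: (@Pol2Trans _ _ (pol2_word_inv u ++ (v ++ pol2_word_inv v))).
  rewrite -{1}[pol2_word_inv u]cats0.
  by apply: Pol2Cat; [apply: Pol2Refl | apply/Pol2Sym/pol2_mulwV].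
rewrite catA -[X in pol2_eqv _ X]cat0s.
apply: Pol2Cat; last exact: Pol2Refl.
apply: Pol2Trans (pol2_mulVw u).
by apply: Pol2Cat; [apply: Pol2Refl | apply: Pol2Sym].
Qed.

Definition pol2_mul x y : Pol2 G := pol2_pi (repr x ++ repr y).
Definition pol2_one : Pol2 G := pol2_pi [::].
Definition pol2_inv x : Pol2 G := pol2_pi (pol2_word_inv (repr x)).

Lemma pol2_mulE u v : pol2_mul (pol2_pi u) (pol2_pi v) = pol2_pi (u ++ v).
Proof. by apply/pol2_piP; apply: Pol2Cat; apply: pol2_repr_pi. Qed.

Lemma pol2_invE u : pol2_inv (pol2_pi u) = pol2_pi (pol2_word_inv u).
Proof. exact/pol2_piP/pol2_word_inv_eqv/pol2_repr_pi. Qed.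

Fact pol2_mulA : associative pol2_mul.
Proof.
move=> x y z; rewrite -[x]pol2_piK -[y]pol2_piK -[z]pol2_piK.
by rewrite !pol2_mulE catA.
Qed.

Fact pol2_mul1 : left_id pol2_one pol2_mul.
Proof. by move=> x; rewrite -[x]pol2_piK pol2_mulE. Qed.

Fact pol2_mulr1 : right_id pol2_one pol2_mul.
Proof. by move=> x; rewrite -[x]pol2_piK pol2_mulE cats0. Qed.

Fact pol2_mulV : left_inverse pol2_one pol2_inv pol2_mul.
Proof.
move=> x; rewrite -[x]pol2_piK pol2_invE pol2_mulE.
exact/pol2_piP/pol2_mulVw.
Qed.

Fact pol2_mulrV : right_inverse pol2_one pol2_inv pol2_mul.
Proof.
move=> x; rewrite -[x]pol2_piK pol2_invE pol2_mulE.
exact/pol2_piP/pol2_mulwV.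
Qed.

HB.instance Definition _ := isGroup.Build (Pol2 G)
  pol2_mulA pol2_mul1 pol2_mulr1 pol2_mulV pol2_mulrV.

Definition pol2_gen (g : G) : Pol2 G := pol2_pi [:: (g, false)].

Lemma pol2_genV g : (pol2_gen g)^-1 = pol2_pi [:: (g, true)].
Proof. exact: pol2_invE. Qed.

Lemma pol2_piM u v : pol2_pi (u ++ v) = pol2_pi u * pol2_pi v.
Proof. by rewrite -pol2_mulE. Qed.

Lemma pol2_pi_cons g b u :
  pol2_pi ((g, b) :: u) =
    (if b then (pol2_gen g)^-1 else pol2_gen g) * pol2_pi u.
Proof. by rewrite -cat1s pol2_piM; case: b => //; rewrite pol2_genV. Qed.

Lemma pol2_rel g1 g2 g3 :
  pol2_gen (g1 * g2 * g3) =
    pol2_gen (g1 * g2) * (pol2_gen g2)^-1 * (pol2_gen g1)^-1 *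
    pol2_gen (g1 * g3) * (pol2_gen g3)^-1 * pol2_gen (g2 * g3).
Proof.
have /pol2_piP := Pol2Rel g1 g2 g3.
have pi1 : pol2_pi [::] = 1 :> Pol2 G by [].
by rewrite !pol2_pi_cons pi1 !mulg1 !mulgA.
Qed.

End Pol2Group.

(** * Universal property *)

Section UniversalProperty.
Variables G H : groupType.
Implicit Type f : G -> H.

Lemma unital_quadraticP f :
  unital f /\ quadratic f <->
  forall g1 g2 g3, f (g1 * g2 * g3) =
    f (g1 * g2) * (f g2)^-1 * (f g1)^-1 * f (g1 * g3) * (f g3)^-1 * f (g2 * g3).
Proof.
split=> [[f1 qf] g1 g2 g3 | fE].
  have /(canRL (mulgVK _)) := qf g1 g2 g3 1.
  rewrite mul1g /Delta !mulg1 [f 1]f1 invg1 mulg1 mulgA => /(canRL (mulgVK _)).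
  by move=> /(canRL (mulgVK _)) ->; rewrite !mulgA.
have f1 : unital f.
  by rewrite /unital; have := fE 1 1 1; rewrite !mulg1 => ->; rewrite mulgV mul1g
    mulVg mul1g mulVg.
split=> // k1 k2 k3 g /=.
suff DE h : Delta k2 (Delta k1 f) h = f (k1 * k2) / f k2 / f k1.
  by rewrite {1}/Delta !DE mulgV.
by rewrite /Delta mulgA fE !invgM invgK !mulgA !mulgK mulgVK mulgK.
Qed.

Definition letter_eval f (l : G * bool) : H :=
  if l.2 then (f l.1)^-1 else f l.1.

Definition word_eval f (u : pol2_word G) : H := \prod_(l <- u) letter_eval f l.

Lemma word_eval_eqv f u v : unital f -> quadratic f ->
  pol2_eqv u v -> word_eval f u = word_eval f v.
Proof.
move=> f1 qf; rewrite /word_eval.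
elim=> {u v} [//|u v _ -> //|u v w _ -> _ -> //|u u' v v' _ Eu _ Ev||].
- by rewrite !big_cat Eu Ev.
- case=> g [] /=; rewrite !big_cons !big_nil /letter_eval /= mulg1 ?mulVg //.
  by rewrite mulgV.
move=> g1 g2 g3; rewrite !big_cons !big_nil /letter_eval /= !mulg1 !mulgA.
by have /unital_quadraticP -> := conj f1 qf.
Qed.

End UniversalProperty.

Theorem pol2_gen_unital_quadratic (G : groupType) :
  unital (@pol2_gen G) /\ quadratic (@pol2_gen G).
Proof. exact/unital_quadraticP/pol2_rel. Qed.

Theorem Pol2_universal (G H : groupType) (f : G -> H) :
  unital f -> quadratic f ->
  exists2 h : {multiplicative Pol2 G -> H}, forall g, h (pol2_gen g) = f g &
    forall h' : {multiplicative Pol2 G -> H},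
      (forall g, h' (pol2_gen g) = f g) -> h' =1 h.
Proof.
move=> f1 qf.
pose h0 (x : Pol2 G) := word_eval f (repr x).
have h0E u : h0 (pol2_pi u) = word_eval f u.
  exact/word_eval_eqv/pol2_repr_pi.
have h0M : {morph h0 : x y / x * y}.
  move=> x y; rewrite -[x]pol2_piK -[y]pol2_piK -pol2_piM !h0E.
  by rewrite /word_eval big_cat.
pose hM := isMultiplicative.Build _ _ h0 h0M.
pose h : {multiplicative Pol2 G -> H} := HB.pack h0 hM.
have hE g : h (pol2_gen g) = f g.
  by rewrite /= /pol2_gen h0E /word_eval big_seq1.
exists h => // h' h'E x; rewrite -[x]pol2_piK.
have k1 (k : {multiplicative Pol2 G -> H}) : k 1 = 1.
  by apply: (mulgI (k 1)); rewrite -gmulfM !mulg1.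
elim: (repr x) => [|[g b] u IHu]; first by rewrite !k1.
rewrite -cat1s pol2_piM !gmulfM IHu; congr (_ * _).
case: b; last by rewrite h'E hE.
rewrite -pol2_genV; apply: (mulgI (f g)).
by rewrite -{1}h'E -hE -!gmulfM mulgV !k1.
Qed.

(* Main.v *)
Require Import Defs.
From mathcomp Require Import fingroup.
From mathcomp Require Import all_boot.
From mathcomp Require Import boolp classical_sets functions cardinality.

(** Let [f] be a unital quadratic map and [B(x, y) = f(xy) f(y)^-1 f(x)^-1].
    Then [B(x, -)] is a homomorphism for every [x], while
    [B(xy, z) = B(x, y) (B(x, z) f(x) B(y, z) f(x)^-1) B(x, y)^-1].
    The latter shows that the subgroup [N] generated by the values of [B] is
    normalised by the values of [f].  Expanding [B(xy, zw)] in both variables,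
    in either order, shows that [B(x, w)] commutes with
    [f(x) B(y, z) f(x)^-1], hence with [f(x) N f(x)^-1 = N]: so [N] is abelian.
    For a finite domain [G], this makes every element of [N] a product over
    [x] of a single [B(x, h(x))], so [N] is finite; and the values of [f]
    generate the finite union of the cosets [N f(g)]. *)

Set Implicit Arguments.
Unset Strict Implicit.
Unset Printing Implicit Defensive.

Local Open Scope group_scope.

Section Defect.
Variables (G H : groupType) (f : G -> H).
Hypotheses (f1 : unital f) (qf : quadratic f).
Implicit Types (x y z w : G) (m n : H).

Definition defect x y : H := f (x * y) / f y / f x.

Lemma defectK x y : f (x * y) = defect x y * f x * f y.
Proof. by rewrite /defect !mulgVK. Qed.

(** The identity of [unital_quadraticP], rearranged. *)
Lemma defectMr x y z : defect x (y * z) = defect x y * defect x z.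
Proof.
have /unital_quadraticP fE := conj f1 qf.
by rewrite /defect mulgA fE !mulgA !mulgK.
Qed.

Lemma defectx1 x : defect x 1 = 1.
Proof. by rewrite /defect mulg1 [f 1]f1 divg1 mulgV. Qed.

Lemma defectVr x y : defect x y^-1 = (defect x y)^-1.
Proof. by apply/esym/mulg1_eq; rewrite -defectMr mulgV defectx1. Qed.

Lemma defectMl x y z :
  defect (x * y) z = (defect x z * defect y z ^ (f x)^-1) ^ (defect x y)^-1.
Proof.
rewrite {1}/defect -(mulgA x) [f (x * (y * z))]defectK defectMr.
rewrite [f (y * z)]defectK.
by rewrite [f (x * y)]defectK !conjgE !invgM !invgK !mulgA !mulgK.
Qed.

Lemma quadraticV x : (f x)^-1 = f x^-1 * defect x x^-1.
Proof.
have /mulg1_eq <- : defect x x^-1 * f x * f x^-1 = 1.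
  by rewrite -defectK mulgV [f 1]f1.
by rewrite invgM mulgVK.
Qed.

(** By [defectVr], products without inverses already form the subgroup [N]. *)
Definition defect_gen n : Prop :=
  exists s : seq (G * G), n = \prod_(p <- s) defect p.1 p.2.

Lemma defect_gen_defect x y : defect_gen (defect x y).
Proof. by exists [:: (x, y)]; rewrite big_seq1. Qed.

Lemma defect_genM m n : defect_gen m -> defect_gen n -> defect_gen (m * n).
Proof. by move=> [s ->] [t ->]; exists (s ++ t); rewrite big_cat. Qed.

Lemma defect_genV n : defect_gen n -> defect_gen n^-1.
Proof.
move=> [s ->]; elim: s => [|p s IHs].
  by exists [::]; rewrite !big_nil invg1.
rewrite big_cons invgM; apply: defect_genM => //.
by rewrite -defectVr; apply: defect_gen_defect.
Qed.

Lemma defect_genJV x n : defect_gen n -> defect_gen (n ^ (f x)^-1).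
Proof.
move=> [s ->]; elim: s => [|[y z] s IHs].
  by exists [::]; rewrite !big_nil conj1g.
rewrite big_cons conjMg; apply: defect_genM => //=.
have -> : defect y z ^ (f x)^-1
    = (defect x z)^-1 * (defect (x * y) z ^ defect x y).
  by rewrite defectMl conjgKV mulKg.
have gB := defect_gen_defect.
apply: defect_genM; first exact: defect_genV.
by rewrite conjgE; do 2?apply: defect_genM => //; apply: defect_genV.
Qed.

(** By [quadraticV], [f x] is [(f x^-1)^-1] up to a factor in [N], which reduces the claim to
    [defect_genJV]. *)
Lemma defect_genJ x n : defect_gen n -> defect_gen (n ^ f x).
Proof.
move=> gn; rewrite -[f x]invgK quadraticV invgM conjgM; apply: defect_genJV.
have gB := defect_gen_defect x x^-1.
by rewrite conjgE invgK; do 2?apply: defect_genM => //; apply: defect_genV.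
Qed.

Lemma commute_defect_J x y z w :
  commute (defect x w) (defect y z ^ (f x)^-1).
Proof.
have := defectMl x y (z * w).
rewrite defectMr !defectMl -conjMg !defectMr => /conjg_inj.
rewrite conjMg.
(* With these names the two expansions read [a * c * b * d = a * b * c * d]. *)
move: (defect x z) (defect x w) (_ y z ^ _) (_ y w ^ _) => a b c d.
by rewrite !mulgA => /mulIg; rewrite -!mulgA => /mulgI.
Qed.

Lemma commute_defect_gen x w n : defect_gen n -> commute (defect x w) n.
Proof.
move=> /(defect_genJ x) [s nE]; rewrite -[n](conjgK (f x)) nE conjg_prod.
by apply: commute_prod => -[y z] _; apply: commute_defect_J.
Qed.

End Defect.

Section FiniteDomain.
Variables (G : finGroupType) (H : groupType) (f : G -> H).
Hypotheses (f1 : unital f) (qf : quadratic f).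

(** As [N] is abelian, factors with the same first argument can be gathered, and [defectMr] merges
    them. *)
Lemma defect_gen_ffun n : defect_gen f n ->
  exists h : {ffun G -> G}, n = \prod_x defect f x (h x).
Proof.
move=> [s ->]; elim: s => [|[x y] s [h IHs]].
  exists [ffun=> 1]; rewrite big_nil big1 // => x _.
  by rewrite ffunE defectx1.
exists [ffun z => (if z == x then y else 1) * h z].
rewrite big_cons IHs.
under [RHS]eq_bigr do rewrite ffunE defectMr //.
rewrite [RHS]prodgM_commute; last first.
  by move=> *; apply: commute_defect_gen => //; apply: defect_gen_defect.
congr (_ * _).
have <- : \prod_(z | z == x) defect f z y = defect f x y.
  exact: big_pred1_eq.
rewrite big_mkcond; apply: eq_bigr => z _ /=.
by case: eqP => // _; rewrite defectx1.
Qed.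

Lemma word_eval_defect_gen (u : pol2_word G) :
  exists n g, defect_gen f n /\ word_eval f u = n * f g.
Proof.
have gB := @defect_gen_defect _ _ f.
(* Moving [f x] past [m] conjugates [m]; then [f x * f g] is [f (x * g)] up to a factor in [N]. *)
have stepM x m g : defect_gen f m ->
    exists n g', defect_gen f n /\ f x * (m * f g) = n * f g'.
  move=> gm; exists (m ^ (f x)^-1 * (defect f x g)^-1), (x * g); split.
    by apply: defect_genM; [apply: defect_genJV | apply: defect_genV].
  rewrite (defectK f x g); move: (defect f x g) => b.
  by rewrite conjgE invgK !mulgA !mulgVK.
elim: u => [|[x b] u [m [g [gm IHu]]]].
  exists 1, 1; split; first by exists [::]; rewrite big_nil.
  by rewrite /word_eval big_nil [f 1]f1 mulg1.
rewrite /word_eval big_cons -/(word_eval f u) IHu /letter_eval /=.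
case: b; last exact: stepM.
(* An inverse letter becomes [f x^-1], its extra defect being absorbed into [m]. *)
rewrite (quadraticV f1) -mulgA [defect _ _ _ * _]mulgA.
exact/stepM/defect_genM.
Qed.

Lemma finite_range_word_eval : finite_set (range (word_eval f)).
Proof.
apply: (@sub_finite_set _ _
  (range (fun p : {ffun G -> G} * G => (\prod_x defect f x (p.1 x)) * f p.2))).
  move=> _ [u _ <-]; have [n [g [/defect_gen_ffun [h ->] ->]]] :=
    word_eval_defect_gen u.
  by exists (h, g).
exact/finite_image/finite_finset.
Qed.

End FiniteDomain.

(** For the universal map, word evaluation is thus onto [Pol2 G], so a finite range means a finite
    group. *)
Lemma pol2_pi_word_eval (G : groupType) (u : pol2_word G) :
  pol2_pi u = word_eval (@pol2_gen G) u.
Proof.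
rewrite /word_eval; elim: u => [|[g b] u IHu]; first by rewrite big_nil.
by rewrite big_cons -IHu pol2_pi_cons.
Qed.

Theorem corollary4p4 (G : finGroupType) : finite_set [set: Pol2 G].
Proof.
have [f1 qf] := pol2_gen_unital_quadratic G.
apply: sub_finite_set (finite_range_word_eval f1 qf) => x _.
by exists (repr x); rewrite // -pol2_pi_word_eval pol2_piK.
Qed.
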